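(* Let $\Lambda$ be a row-finite $k$-graph with no sources, and let $\phi\in Z^2(\Lambda,\mathbb{T})$. Let $c_\phi\in\underline{Z}^2(\Lambda,\mathbb{T})$ be the categorical $2$-cocycle obtained from $\phi$. Let $\{p_v:v\in\Lambda^0\}$ and $\{s_\lambda:\lambda\in\bigsqcup_{i=1}^k\Lambda^{e_i}\}$ be the universal generating Cuntz--Krieger $\phi$-representation of $\Lambda$ in $C^*_\phi(\Lambda)$. For $v\in\Lambda^0$ let $t_v:=p_v$, and for $\lambda\in\Lambda\setminus\Lambda^0$ set $t_\lambda:=s_{\overline{\lambda}_1}\cdots s_{\overline{\lambda}_{|\lambda|}}$. Then $t:\lambda\mapsto t_\lambda$ is a Cuntz--Krieger $(\Lambda,c_\phi)$-family in $C^*_\phi(\Lambda)$. Moreover, this family is universal in the sense that given any Cuntz--Krieger $(\Lambda,c_\phi)$-family $\{t'_\lambda:\lambda\in\Lambda\}$ in a $C^*$-algebra $B$, there is a homomorphism $\pi:C^*_\phi(\Lambda)\to B$ such that $\pi(t_\lambda)=t'_\lambda$ for all $\lambda\in\Lambda$.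
   Context: $k$-graphs. For a nonnegative integer $k$, a $k$-graph is a nonempty countable small category $\Lambda$ with a functor $d:\Lambda\to\mathbb{N}^k$ (the degree; $0\in\mathbb{N}$) with the factorisation property: whenever $d(\lambda)=m+n$ with $m,n\in\mathbb N^k$ there are unique $\mu,\nu\in\Lambda$ with $d(\mu)=m$, $d(\nu)=n$, $\lambda=\mu\nu$. Write $\Lambda^n=d^{-1}(n)$. The set $\Lambda^0$ is identified with the set of objects (identity morphisms), and $r,s:\Lambda\to\Lambda^0$ are codomain and domain; $\mu\nu$ is defined iff $s(\mu)=r(\nu)$. Let $e_1,\dots,e_k$ be the generators of $\mathbb{N}^k$, $|n|=\sum_i n_i$, $|\lambda|=|d(\lambda)|$, and $v\Lambda^n=\{\lambda\in\Lambda^n:r(\lambda)=v\}$. $\Lambda$ is row-finite if every $v\Lambda^n$ is finite, and has no sources if every $v\Lambda^n$ is nonempty ($v\in\Lambda^0,n\in\mathbb{N}^k$). The group $\mathbb{T}$ (unit circle) is written multiplicatively. Cubical cocycles. Let $Q_r(\Lambda)=\{\lambda: d(\lambda)\le(1,\dots,1),|\lambda|=r\}$. If $\lambda\in Q_3(\Lambda)$ has $d(\lambda)=e_{i_1}+e_{i_2}+e_{i_3}$, $i_1<i_2<i_3$, then $F_j^0(\lambda),F_j^1(\lambda)$ are the unique elements of $\Lambda^{d(\lambda)-e_{i_j}}$ with $\lambda=F_j^0(\lambda)\beta=\alpha F_j^1(\lambda)$ for some $\alpha,\beta\in\Lambda^{e_{i_j}}$. $Z^2(\Lambda,\mathbb{T})$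 is the group of functions $\phi:Q_2(\Lambda)\to\mathbb{T}$ with $\phi(F^0_3(\lambda))\phi(F^1_2(\lambda))\phi(F^0_1(\lambda))=\phi(F^1_1(\lambda))\phi(F^0_2(\lambda))\phi(F^1_3(\lambda))$ for all $\lambda\in Q_3(\Lambda)$. Categorical cocycles. $\Lambda^{*r}$ is the set of composable $r$-tuples. $\underline{Z}^2(\Lambda,\mathbb{T})$ is the group of functions $c:\Lambda^{*2}\to\mathbb{T}$ with $c(\lambda_1,\lambda_2)=1$ if $\lambda_1$ or $\lambda_2$ is in $\Lambda^0$, and $c(\lambda_1,\lambda_2)c(\lambda_1\lambda_2,\lambda_3)=c(\lambda_2,\lambda_3)c(\lambda_1,\lambda_2\lambda_3)$ on $\Lambda^{*3}$. The cocycle $c_\phi$. Let $E_\Lambda$ be the path category of the directed graph with vertices $\Lambda^0$, edges $\bigcup_i\Lambda^{e_i}$ and $r,s$ from $\Lambda$ (elements: vertices and formal strings $u=u_1\cdots u_n$ of edges with $s(u_i)=r(u_{i+1})$). For $e\in\Lambda^{e_i}$ put $C(e)=i$. Let $\pi:E_\Lambda\to\Lambda$ be the functor composing strings in $\Lambda$. For $\lambda\in\Lambda$, $\overline\lambda=\overline\lambda_1\cdots\overline\lambda_{|\lambda|}$ is the unique element of $E_\Lambda$ with $\pi(\overline\lambda)=\lambda$ and $C(\overline\lambda_i)\le C(\overline\lambda_{i+1})$ for all $i$. An allowable transition is a pair $(u,w)$ in $E_\Lambda$ with $\pi(u)=\pi(w)$ for which there is $i$ with $u_j=w_j$ for $j\notin\{i,i+1\}$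 and $C(w_{i+1})=C(u_i)<C(u_{i+1})=C(w_i)$; put $\tilde\phi(u,w)=\phi(\pi(u_iu_{i+1}))$. For $w\in E_\Lambda$ choose $w=w^0,w^1,\dots,w^n=\overline{\pi(w)}$ with each $(w^j,w^{j-1})$ an allowable transition; $S_\phi(w):=\prod_j\tilde\phi(w^j,w^{j-1})$ is independent of the choice. Then $c_\phi(\mu,\nu):=S_\phi(\overline\mu\,\overline\nu)$ defines an element of $\underline{Z}^2(\Lambda,\mathbb{T})$. $\phi$-representations. A Cuntz--Krieger $\phi$-representation of $\Lambda$ in a $C^*$-algebra $A$ is a set $\{p_v:v\in\Lambda^0\}\subseteq A$ of mutually orthogonal projections and a set $\{s_\lambda:\lambda\in\bigcup_i\Lambda^{e_i}\}\subseteq A$ with: (1) $s_\lambda^*s_\lambda=p_{s(\lambda)}$ for each edge $\lambda$; (2) if $1\le i<j\le k$, $\mu,\mu'\in\Lambda^{e_i}$, $\nu,\nu'\in\Lambda^{e_j}$ and $\mu\nu=\nu'\mu'$, then $s_{\nu'}s_{\mu'}=\phi(\mu\nu)s_\mu s_\nu$; (3) $p_v=\sum_{\lambda\in v\Lambda^{e_i}}s_\lambda s_\lambda^*$ whenever $v\in\Lambda^0$, $1\le i\le k$ and $v\Lambda^{e_i}\ne\emptyset$. $C^*_\phi(\Lambda)$ is the universal $C^*$-algebra generated by a Cuntz--Krieger $\phi$-representation. $(\Lambda,c)$-families. For $c\in\underline{Z}^2(\Lambda,\mathbb{T})$, a Cuntz--Krieger $(\Lambda,c)$-family in a $C^*$-algebra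 $B$ is a function $t:\Lambda\to B$, $\lambda\mapsto t_\lambda$, with: (CK1) $\{t_v:v\in\Lambda^0\}$ are mutually orthogonal projections; (CK2) $t_\mu t_\nu=c(\mu,\nu)t_{\mu\nu}$ whenever $s(\mu)=r(\nu)$; (CK3) $t_\lambda^*t_\lambda=t_{s(\lambda)}$; (CK4) $t_v=\sum_{\lambda\in v\Lambda^n}t_\lambda t_\lambda^*$ for all $v\in\Lambda^0,n\in\mathbb{N}^k$. *)

(* Defs.v *)
From HB Require Import structures.
From mathcomp Require Import all_boot all_order all_algebra.
From mathcomp Require Import complex.
From mathcomp Require Import boolp classical_sets functions cardinality fsbigop.
From mathcomp Require Import reals topology normedtype.

Set Implicit Arguments.
Unset Strict Implicit.
Unset Printing Implicit Defensive.

Import Order.TTheory GRing.Theory Num.Theory.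
Import numFieldNormedType.Exports.

Local Open Scope classical_set_scope.
Local Open Scope complex_scope.
Local Open Scope ring_scope.

(* C*-algebras are complex and not assumed unital, so the product cannot be
   that of a MathComp ring. The norm takes its (real) values in R[i]. *)
HB.mixin Record CompleteNormedModule_isCStarAlgebra (R : realType) A
    of CompleteNormedModule R[i] A := {
  cmul : A -> A -> A;
  cstar : A -> A;
  cmulA : associative cmul;
  cmulDl : left_distributive cmul +%R;
  cmulDr : right_distributive cmul +%R;
  cmulZl : forall (a : R[i]) (x y : A), cmul (a *: x) y = a *: cmul x y;
  cmulZr : forall (a : R[i]) (x y : A), cmul x (a *: y) = a *: cmul x y;
  cstarK : involutive cstar;
  cstarD : {morph cstar : x y / x + y};
  cstarZ : forall (a : R[i]) (x : A), cstar (a *: x) = Num.conj a *: cstar x;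
  cstarM : forall x y : A, cstar (cmul x y) = cmul (cstar y) (cstar x);
  cnormM_le : forall x y : A, `|cmul x y| <= `|x| * `|y|;
  cnorm_cstar : forall x : A, `|cmul (cstar x) x| = `|x| ^+ 2
}.

#[short(type="cstarAlgType")]
HB.structure Definition CStarAlgebra (R : realType) :=
  {A of CompleteNormedModule_isCStarAlgebra R A & CompleteNormedModule R[i] A}.

Notation "x ** y" := (cmul x y) (at level 40, left associativity) : ring_scope.
Notation "x ^†" := (cstar x) (at level 2, format "x ^†") : ring_scope.

Section CStar.
Variable R : realType.

Definition star_hom (A B : cstarAlgType R) (f : {linear A -> B}) : Prop :=
  (forall x y : A, f (x ** y) = f x ** f y) /\ (forall x : A, f x^† = (f x)^†).

Definition star_subalgebra (A : cstarAlgType R) (S : set A) : Prop :=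
  [/\ S 0,
      forall (a : R[i]) x y, S x -> S y -> S (a *: x + y),
      forall x y, S x -> S y -> S (x ** y)
    & forall x, S x -> S x^†].

Definition generates (A : cstarAlgType R) (G : set A) : Prop :=
  forall S : set A, star_subalgebra S -> closed S -> G `<=` S -> S = setT.

Definition projection (A : cstarAlgType R) (x : A) : Prop :=
  x ** x = x /\ x^† = x.

Definition orthogonal_projections (I : Type) (A : cstarAlgType R)
    (p : I -> A) : Prop :=
  (forall v, projection (p v)) /\ (forall v w, v <> w -> p v ** p w = 0).

(* The product s e_1 ** ... ** s e_n of a nonempty sequence; the value on the
   empty sequence is irrelevant (there may be no unit). *)
Definition seq_prod (E : Type) (A : cstarAlgType R) (s : E -> A) (u : seq E) : A :=
  if u is e :: u' then foldl (fun a f => a ** s f) (s e) u' else 0.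

End CStar.

Definition basis k (i : 'I_k) : {ffun 'I_k -> nat} := [ffun j => (j == i : nat)].

(* [comp mu nu] is meaningful only when [src mu = rng nu]. *)
Record kgraph (k : nat) := KGraph {
  vertex : countType;
  mor : countType;
  rng : mor -> vertex;
  src : mor -> vertex;
  idm : vertex -> mor;
  comp : mor -> mor -> mor;
  deg : mor -> {ffun 'I_k -> nat};
  kgraph_nonempty : inhabited mor;
  rng_idm : forall v, rng (idm v) = v;
  src_idm : forall v, src (idm v) = v;
  rng_comp : forall mu nu, src mu = rng nu -> rng (comp mu nu) = rng mu;
  src_comp : forall mu nu, src mu = rng nu -> src (comp mu nu) = src nu;
  comp_idl : forall lam, comp (idm (rng lam)) lam = lam;
  comp_idr : forall lam, comp lam (idm (src lam)) = lam;
  compA : forall lam mu nu, src lam = rng mu -> src mu = rng nu ->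
    comp lam (comp mu nu) = comp (comp lam mu) nu;
  deg_idm : forall v, deg (idm v) = 0;
  deg_comp : forall mu nu, src mu = rng nu ->
    deg (comp mu nu) = deg mu + deg nu;
  factorisation : forall lam (m n : {ffun 'I_k -> nat}), deg lam = m + n ->
    exists! x : mor * mor,
      [/\ deg x.1 = m, deg x.2 = n, src x.1 = rng x.2 & lam = comp x.1 x.2]
}.

Section KGraph.
Variables (k : nat) (L : kgraph k).
Implicit Types (lam mu nu : mor L) (v : vertex L).

Definition total_deg lam : nat := (\sum_(i < k) deg lam i)%N.

Definition row_finite : Prop := forall v (n : {ffun 'I_k -> nat}),
  finite_set [set lam | rng lam = v /\ deg lam = n].

Definition no_sources : Prop := forall v (n : {ffun 'I_k -> nat}),
  exists lam, rng lam = v /\ deg lam = n.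

(* The disjoint union over i of the sets of morphisms of degree e_i. *)
Definition edge : Type := {x : mor L * 'I_k | deg x.1 == basis x.2}.
HB.instance Definition _ := Countable.on edge.
Definition edge_mor (e : edge) : mor L := (val e).1.
Definition color (e : edge) : 'I_k := (val e).2.

Definition in_Q (r : nat) lam : Prop :=
  (forall i, (deg lam i <= 1)%N) /\ total_deg lam = r.

(* The faces are indexed by the colour i_j rather than by its position j;
   the default value lam is never used when the e_i-component of the degree
   of lam is nonzero. *)
Definition face0 (i : 'I_k) lam : mor L :=
  xget lam [set mu | deg mu + basis i = deg lam /\
    exists beta, [/\ deg beta = basis i, src mu = rng beta & lam = comp mu beta]].

Definition face1 (i : 'I_k) lam : mor L :=
  xget lam [set mu | deg mu + basis i = deg lam /\
    exists alpha, [/\ deg alpha = basis i, src alpha = rng mu & lam = comp alpha mu]].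

(* A function on Q_2 is encoded by a function on all morphisms; its values
   outside Q_2 are irrelevant. *)
Definition cubical_cocycle (R : realType) (phi : mor L -> R[i]) : Prop :=
  (forall lam, in_Q 2 lam -> `|phi lam| = 1) /\
  (forall lam (i1 i2 i3 : 'I_k), in_Q 3 lam -> (i1 < i2 < i3)%N ->
    deg lam = basis i1 + basis i2 + basis i3 ->
    phi (face0 i3 lam) * phi (face1 i2 lam) * phi (face0 i1 lam) =
    phi (face1 i1 lam) * phi (face0 i2 lam) * phi (face1 i3 lam)).

(* An element of E_L is given by its range and its sequence of edges, subject
   to [in_E]; a vertex v is (v, [::]). *)
Fixpoint is_string v (u : seq edge) : Prop :=
  if u is e :: u' then rng (edge_mor e) = v /\ is_string (src (edge_mor e)) u'
  else True.

Definition in_E (w : vertex L * seq edge) : Prop := is_string w.1 w.2.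

Fixpoint comp_string v (u : seq edge) : mor L :=
  if u is e :: u' then comp (edge_mor e) (comp_string (src (edge_mor e)) u')
  else idm v.

Definition path_mor (w : vertex L * seq edge) : mor L := comp_string w.1 w.2.

Definition path_cat (w w' : vertex L * seq edge) : vertex L * seq edge :=
  (w.1, w.2 ++ w'.2).

Definition ordered_path lam : vertex L * seq edge :=
  xget (rng lam, [::]) [set w | [/\ in_E w, path_mor w = lam
    & sorted (fun e f => color e <= color f)%N w.2]].

Variables (R : realType) (phi : mor L -> R[i]).

(* (u, w) is an allowable transition and z is the value of phi-tilde at it. *)
Definition transition (u w : vertex L * seq edge) (z : R[i]) : Prop :=
  [/\ in_E u, in_E w, path_mor u = path_mor w
    & exists (a b : seq edge) (e f e' f' : edge),
      [/\ u.2 = a ++ [:: e; f] ++ b, w.2 = a ++ [:: e'; f'] ++ b,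
          [/\ color f' = color e, (color e < color f)%N & color f = color e']
        & z = phi (comp (edge_mor e) (edge_mor f))]].

(* There are w = w^0, ..., w^n = u with each (w^j, w^(j-1)) an allowable
   transition, and z is the product of the values of phi-tilde at them. *)
Inductive sorting : vertex L * seq edge -> vertex L * seq edge -> R[i] -> Prop :=
| SortingNil w : sorting w w 1
| SortingCons w w1 u z1 z :
    transition w1 w z1 -> sorting w1 u z -> sorting w u (z1 * z).

(* The chain being immaterial when phi is a cocycle, an arbitrary one is used. *)
Definition S_ (w : vertex L * seq edge) : R[i] :=
  xget 1 [set z | sorting w (ordered_path (path_mor w)) z].

Definition c_ mu nu : R[i] := S_ (path_cat (ordered_path mu) (ordered_path nu)).

Definition phi_representation (A : cstarAlgType R)
    (p : vertex L -> A) (s : edge -> A) : Prop :=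
  [/\ orthogonal_projections p,
      forall e : edge, (s e)^† ** s e = p (src (edge_mor e)),
      forall mu mu' nu nu' : edge,
        color mu = color mu' -> color nu = color nu' ->
        (color mu < color nu)%N ->
        src (edge_mor mu) = rng (edge_mor nu) ->
        src (edge_mor nu') = rng (edge_mor mu') ->
        comp (edge_mor mu) (edge_mor nu) = comp (edge_mor nu') (edge_mor mu') ->
        s nu' ** s mu' =
          phi (comp (edge_mor mu) (edge_mor nu)) *: (s mu ** s nu)
    & forall v (i : 'I_k),
        let vLi := [set e : edge | rng (edge_mor e) = v /\ color e = i] in
        vLi !=set0 -> p v = \sum_(e \in vLi) s e ** (s e)^†].

(* A, with (p, s), is the C*-algebra of phi: A is generated by (p, s), and
   every phi-representation is the image of (p, s) under a homomorphism. *)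
Definition universal_phi_representation (A : cstarAlgType R)
    (p : vertex L -> A) (s : edge -> A) : Prop :=
  [/\ phi_representation p s,
      generates (range p `|` range s)
    & forall (B : cstarAlgType R) (p' : vertex L -> B) (s' : edge -> B),
        phi_representation p' s' ->
        exists f : {linear A -> B}, [/\ star_hom f,
          forall v, f (p v) = p' v & forall e, f (s e) = s' e]].

Definition twisted_family (c : mor L -> mor L -> R[i]) (B : cstarAlgType R)
    (t : mor L -> B) : Prop :=
  [/\ orthogonal_projections (fun v => t (idm v)),
      forall mu nu, src mu = rng nu -> t mu ** t nu = c mu nu *: t (comp mu nu),
      forall lam, (t lam)^† ** t lam = t (idm (src lam))
    & forall v (n : {ffun 'I_k -> nat}),
        t (idm v) =
          \sum_(lam \in [set lam | rng lam = v /\ deg lam = n]) t lam ** (t lam)^†].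

Definition family_of_representation (A : cstarAlgType R)
    (p : vertex L -> A) (s : edge -> A) (lam : mor L) : A :=
  if deg lam == 0 then p (rng lam) else seq_prod s (ordered_path lam).2.

End KGraph.

Arguments edge {k} L.

(* Main.v *)
From mathcomp Require Import all_boot all_order all_algebra complex.
From mathcomp Require Import finmap classical_sets cardinality.
From mathcomp Require Import fsbigop reals normedtype ring zify.
Require Import Defs.

(** Both presentations are generated by the same elements, and the twist
    [c_phi] is designed so that the two sets of relations say the same thing.

    From a representation to a family: an allowable transition exchanges the
    two factorisations of a morphism of degree [e_i + e_j], and the commutation
    relation says that the product of the [s_e] along a string changes by
    exactly the value of [phi] ([string_prod_transition]). Following a chain of
    transitions from [mu nu], written as the concatenation of the two ordered
    strings, to the ordered string of the composite therefore yields
    [t_mu t_nu = c_phi(mu, nu) t_(mu nu)]. Any chain will do for this, provided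
    that one exists ([sorting_exists]). The Cuntz-Krieger relation in degree
    [n] follows from those in the degrees [e_i] by splitting off edges of the
    least colour ([family_CK4]).

    These computations use [p_r(e) s_e = s_e] ([rep_rng]), which is where the
    C*-norm enters: the range projection [s_e s_e^†] is one of finitely many
    projections whose sum is the projection [p_r(e)], and must be shown to lie
    below it ([sum_projections_absorb]). In concrete operators this is
    positivity. In an abstract C*-algebra it is deduced here from an elementary
    form of extremality: a projection [e] is the midpoint of no segment from
    [e - k] to [e + k] in the unit ball with [k] nonzero self-adjoint in the
    corner of [e] ([selfadjoint_extreme]).

    From a family to a representation: the twist is [1] whenever the
    concatenated strings are already ordered ([c_ordered]) and is the value of
    [phi] on a pair of edges in the wrong order ([S_swap]). So the restriction
    of a family to vertices and edges is a representation
    ([family_representation]), and the family is recovered from it by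
    multiplying along ordered strings ([family_string]). The homomorphism given
    by the universal property then carries [t] to the family. *)

Import Order.TTheory GRing.Theory Num.Theory.
Local Open Scope classical_set_scope.
Local Open Scope complex_scope.
Local Open Scope ring_scope.

Set Implicit Arguments.
Unset Strict Implicit.
Unset Printing Implicit Defensive.

(** * Elementary facts about non-unital C*-algebras *)

Section CStarFacts.
Variables (R : realType) (A : cstarAlgType R).
Implicit Types x y z e q : A.

Lemma cmul0l x : 0 ** x = 0.
Proof. by apply: (addrI (0 ** x)); rewrite -cmulDl !addr0. Qed.

Lemma cmul0r x : x ** 0 = 0.
Proof. by apply: (addrI (x ** 0)); rewrite -cmulDr !addr0. Qed.

Lemma cmulNl x y : (- x) ** y = - (x ** y).
Proof. by apply/eqP; rewrite -addr_eq0 -cmulDl addNr cmul0l. Qed.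

Lemma cmulNr x y : x ** (- y) = - (x ** y).
Proof. by apply/eqP; rewrite -addr_eq0 -cmulDr addNr cmul0r. Qed.

Lemma cmulBl x y z : (x - y) ** z = x ** z - y ** z.
Proof. by rewrite cmulDl cmulNl. Qed.

Lemma cmulBr x y z : x ** (y - z) = x ** y - x ** z.
Proof. by rewrite cmulDr cmulNr. Qed.

Lemma cstar0 : (0 : A)^† = 0.
Proof. by apply: (addrI (0 : A)^†); rewrite -cstarD !addr0. Qed.

Lemma cstarN x : (- x)^† = - x^†.
Proof. by apply/eqP; rewrite -addr_eq0 -cstarD addNr cstar0. Qed.

Lemma cstarB x y : (x - y)^† = x^† - y^†.
Proof. by rewrite cstarD cstarN. Qed.

Lemma cmul_sumr (I : Type) (r : seq I) (P : pred I) (F : I -> A) x :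
  x ** (\sum_(i <- r | P i) F i) = \sum_(i <- r | P i) x ** F i.
Proof. by apply: (big_morph (cmul x)) => [y z|]; rewrite ?cmulDr ?cmul0r. Qed.

Lemma cmul_suml (I : Type) (r : seq I) (P : pred I) (F : I -> A) x :
  (\sum_(i <- r | P i) F i) ** x = \sum_(i <- r | P i) F i ** x.
Proof. by apply: (big_morph (cmul^~ x)) => [y z|]; rewrite ?cmulDl ?cmul0l. Qed.

Lemma cstar_sum (I : Type) (r : seq I) (P : pred I) (F : I -> A) :
  (\sum_(i <- r | P i) F i)^† = \sum_(i <- r | P i) (F i)^†.
Proof. by apply: big_morph => [y z|]; rewrite ?cstarD ?cstar0. Qed.

Lemma cstarM_eq0 x : x^† ** x = 0 -> x = 0.
Proof.
move=> xx0; apply/eqP; rewrite -normr_eq0 -sqrf_eq0 -cnorm_cstar xx0.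
by rewrite normr0.
Qed.

Lemma cnorm_star x : `|x^†| = `|x|.
Proof.
have le y : `|y| <= `|y^†|.
  have [->|y0] := eqVneq y 0; first by rewrite cstar0.
  rewrite -(@ler_pM2r _ `|y|) ?normr_gt0// -expr2 -cnorm_cstar.
  exact: cnormM_le.
by apply/eqP; rewrite eq_le le -{2}[x]cstarK le.
Qed.

Lemma projection_norm e : projection e -> `|e| <= 1.
Proof.
case=> ee es; have := cnorm_cstar e; rewrite es ee => /eqP.
have [->|e0] := eqVneq e 0; first by rewrite normr0 ler01.
rewrite -subr_eq0 expr2 -{1}[ `|e| ]mulr1 -mulrBr mulf_eq0 normr_eq0.
by rewrite (negPf e0) subr_eq0 => /eqP <-.
Qed.

(** With a unit, [1 - 2 q] would be a unitary and right multiplication by it an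
    isometry; by the C*-identity the norm equality needs only
    [(x - 2 x q) (x - 2 x q)^† = x x^†], which makes sense without a unit. *)
Lemma norm_mul_symmetry x q : projection q -> `|x - (x ** q) *+ 2| = `|x|.
Proof.
case=> qq qs; rewrite -[LHS]cnorm_star -[RHS]cnorm_star.
apply/eqP; rewrite -(@eqrXn2 _ 2) ?normr_ge0 // -!cnorm_cstar !cstarK.
suff -> : (x - x ** q *+ 2) ** (x - x ** q *+ 2)^† = x ** x^† by [].
rewrite mulr2n !(cstarB, cstarD, cstarM) qs.
have qqx : x ** q ** (q ** x^†) = x ** q ** x^†.
  by rewrite cmulA -(cmulA x) qq.
rewrite !(cmulBl, cmulBr, cmulDl, cmulDr) qqx !cmulA.
set a := x ** x^†; set b := x ** q ** x^†.
by rewrite opprB addrK subrK.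
Qed.

Lemma norm_midpoint x y z :
  `|x| <= 1 -> `|y| <= 1 -> z *+ 2 = x + y -> `|z| <= 1.
Proof.
move=> x1 y1 zE; rewrite -(@ler_pMn2r _ 2) // -normrMn zE.
by rewrite (le_trans (ler_normD _ _)) // mulr2n lerD.
Qed.

Lemma norm_mul_le1 x y : `|x| <= 1 -> `|y| <= 1 -> `|x ** y| <= 1.
Proof. by move=> ? ?; rewrite (le_trans (cnormM_le _ _)) // mulr_ile1. Qed.

End CStarFacts.

(** * Extremality of a projection in the unit ball of its corner *)

Section Horner.
Variables (R : realType) (A : cstarAlgType R) (e x : A).
Hypotheses (ee : e ** e = e) (ex : e ** x = x).

(** Evaluation of polynomials at [x] in the corner [e A e], where [e] plays the
    role of [1]. It is a morphism, so identities between polynomials in [x] can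
    be checked in the commutative ring of polynomials. *)
Definition corner_horner (f : {poly R[i]}) : A :=
  foldr (fun c y => c *: e + x ** y) 0 f.

Lemma corner_horner0 : corner_horner 0 = 0.
Proof. by rewrite /corner_horner polyseq0. Qed.

Lemma corner_hornerMXaddC (f : {poly R[i]}) c :
  corner_horner (f * 'X + c%:P) = c *: e + x ** corner_horner f.
Proof.
rewrite /corner_horner -cons_poly_def polyseq_cons; case: ifP => //.
move=> /negbFE /nilP ->; rewrite polyseqC cmul0r addr0.
by have [->|c0] := eqVneq c 0; rewrite /= ?scale0r ?cmul0r ?addr0.
Qed.

Lemma corner_hornerD (f g : {poly R[i]}) :
  corner_horner (f + g) = corner_horner f + corner_horner g.
Proof.
elim/poly_ind: f g => [|f c IH] g; first by rewrite corner_horner0 !add0r.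
elim/poly_ind: g => [|g d _]; first by rewrite corner_horner0 !addr0.
rewrite addrACA -mulrDl -polyCD !corner_hornerMXaddC IH scalerDl cmulDr.
by rewrite addrACA.
Qed.

Lemma corner_hornerZ c (f : {poly R[i]}) :
  corner_horner (c%:P * f) = c *: corner_horner f.
Proof.
elim/poly_ind: f => [|f d IH]; first by rewrite mulr0 corner_horner0 scaler0.
rewrite mulrDr mulrA -polyCM !corner_hornerMXaddC IH.
by rewrite scalerDr scalerA cmulZr.
Qed.

Lemma corner_horner_unit (f : {poly R[i]}) :
  e ** corner_horner f = corner_horner f.
Proof.
elim/poly_ind: f => [|f d IH]; first by rewrite corner_horner0 cmul0r.
by rewrite corner_hornerMXaddC cmulDr cmulZr ee cmulA ex.
Qed.

Lemma corner_hornerM (f g : {poly R[i]}) :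
  corner_horner (f * g) = corner_horner f ** corner_horner g.
Proof.
elim/poly_ind: f g => [|f d IH] g.
  by rewrite mul0r corner_horner0 cmul0l.
rewrite mulrDl mulrAC corner_hornerD corner_hornerZ -[f * g * 'X]addr0 -polyC0.
rewrite !corner_hornerMXaddC scale0r add0r IH cmulDl cmulZl corner_horner_unit.
by rewrite cmulA addrC.
Qed.

Lemma corner_hornerC c : corner_horner c%:P = c *: e.
Proof.
rewrite -[c%:P]add0r -[0](mul0r 'X) corner_hornerMXaddC.
by rewrite corner_horner0 cmul0r addr0.
Qed.

Lemma corner_hornerX (xe : x ** e = x) : corner_horner 'X = x.
Proof.
rewrite -[RHS]xe -[e]scale1r -corner_hornerC -['X]addr0 -['X]mul1r -polyC0.
by rewrite corner_hornerMXaddC scale0r add0r.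
Qed.

End Horner.

Section Extreme.
Variables (R : realType) (A : cstarAlgType R) (e : A).
Hypothesis (pe : projection e).

(** Put [y = 2 x] and [b = y y]. Multiplying and averaging elements of the unit
    ball puts [e + b] and [e - b] in it. By the C*-identity
    [|e + i y|^2 = |e + b|], so [e + i y] and [e - i y] are in it too, and the
    average of their fourth powers, [e - 6 b + b b], averaged with
    [(e - b) (e + b) = e - b b], gives [e - 3 b]. The coefficient [3] is what
    makes the multiple of [x] grow: with weights 3/4 and 1/4,
    [(e + y)^2 = e + 2 y + b] and [e - 3 b] average to
    [e + (3/2) y = e + 3 x]. *)
Lemma selfadjoint_expand (x : A) : x^† = x -> e ** x = x -> x ** e = x ->
  `|e + x *+ 2| <= 1 -> `|e - x *+ 2| <= 1 ->
  `|e + x *+ 3| <= 1 /\ `|e - x *+ 3| <= 1.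
Proof.
case: pe => ee es xs ex xe lp lm.
pose ev := corner_horner e x.
pose U f := `|ev f| <= 1.
have UM f g : U f -> U g -> U (f * g).
  by move=> *; rewrite /U /ev corner_hornerM //; apply: norm_mul_le1.
have Umid f g h : U f -> U g -> h *+ 2 = f + g -> U h.
  move=> Uf Ug hE; apply: norm_midpoint Uf Ug _.
  by rewrite -corner_hornerD -hE !mulr2n corner_hornerD.
have evX : ev 'X = x by apply: corner_hornerX.
have evL c : ev (1 + c%:P * 'X) = e + c *: x.
  by rewrite /ev corner_hornerD corner_hornerC corner_hornerZ scale1r -/ev evX.
pose Y : {poly R[i]} := 'X *+ 2.
have YE : Y = 2%:P * 'X by rewrite mul_polyC scaler_nat.
have Up : U (1 + Y) by rewrite /U YE evL scaler_nat.
have Um : U (1 - Y).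
  by rewrite /U YE -mulNr -polyCN evL scaleNr scaler_nat.
have Usq : U (1 + Y ^+ 2).
  by apply: (Umid _ _ _ (UM _ _ Up Up) (UM _ _ Um Um)); ring.
pose J : {poly R[i]} := ('i)%:P.
have JJ : J * J = -1 by rewrite -polyCM -expr2 sqrCi polyCN.
(* [1 + c Y] with [c = i] or [c = - i]; its adjoint is [1 - c Y]. *)
have UJ (c : R[i]) : c = 'i \/ c = - 'i -> U (1 + c%:P * Y).
  move=> cE; rewrite /U YE mulrA -polyCM evL.
  rewrite -(@ler_pXn2r _ 2) ?nnegrE ?normr_ge0 // -cnorm_cstar expr1n.
  suff -> : (e + c * 2 *: x)^† ** (e + c * 2 *: x) = ev (1 + Y ^+ 2) by [].
  have -> : (e + c * 2 *: x)^† = ev (1 + (- c * 2)%:P * 'X).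
    rewrite evL cstarD es cstarZ xs rmorphM rmorph_nat.
    by case: cE => ->; rewrite ?rmorphN /= conjCi ?opprK.
  rewrite -evL /ev -corner_hornerM //; congr corner_horner.
  have cc : c%:P * c%:P = -1 :> {poly R[i]}.
    by case: cE => ->; rewrite -polyCM ?mulrNN -expr2 sqrCi polyCN.
  have -> : 1 + Y ^+ 2 = 1 - (c%:P * c%:P) * Y ^+ 2 by rewrite cc mulN1r opprK.
  by rewrite YE !polyCM polyCN; ring.
have UJp := UJ _ (or_introl erefl); have UJm := UJ _ (or_intror erefl).
have U3 : U (1 - Y ^+ 2 *+ 3).
  have U4 : U (1 + J * J * Y ^+ 2 *+ 6 + (J * J) ^+ 2 * Y ^+ 4).
    pose sq4 (f : {poly R[i]}) := f * f * (f * f).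
    apply: (Umid (sq4 (1 + J * Y)) (sq4 (1 + (- 'i)%:P * Y)) _ _ _ _).
    - exact: UM (UM _ _ _ _) (UM _ _ _ _).
    - exact: UM (UM _ _ _ _) (UM _ _ _ _).
    by rewrite /sq4 polyCN -/J; ring.
  apply: (Umid _ _ _ U4 (UM _ _ Usq (UM _ _ Up Um))).
  by rewrite JJ; ring.
have fin z : U (1 + z) -> z * z = Y ^+ 2 -> U (1 + z - Y ^+ 2).
  move=> Uz zz; apply: (Umid _ _ _ (UM _ _ Uz Uz) U3); rewrite -zz; ring.
have fin2 z w : U (1 + z) -> z * z = Y ^+ 2 -> w *+ 2 = z *+ 3 -> U (1 + w).
  move=> Uz zz ww; apply: (Umid _ _ _ (UM _ _ Uz Uz) (fin z Uz zz)).
  by rewrite mulrnDl ww -zz; ring.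
split.
- rewrite -scaler_nat -evL; apply: (fin2 Y) => //; rewrite /Y; ring.
rewrite -scaler_nat -scaleNr -evL; apply: (fin2 (- Y)) => //; rewrite ?/Y; ring.
Qed.

(** Iterating [selfadjoint_expand], [e + (3/2)^n k] and [e - (3/2)^n k] stay in
    the unit ball for all [n], so the difference [2 (3/2)^n k] is bounded.
    This replaces an appeal to the spectral theory of [k]. *)
Lemma selfadjoint_extreme (k : A) : k^† = k -> e ** k = k -> k ** e = k ->
  `|e + k| <= 1 -> `|e - k| <= 1 -> k = 0.
Proof.
move=> ks ek ke lp lm.
pose c n : R[i] := (3 / 2) ^+ n.
have cs n : Num.conj (c n / 2) = c n / 2.
  by rewrite fmorph_div rmorphXn /= fmorph_div !rmorph_nat.
have grow n : `|e + c n *: k| <= 1 /\ `|e - c n *: k| <= 1.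
  elim: n => [|n [IHp IHm]]; first by rewrite /c expr0 scale1r.
  have half : c n *: k = ((c n / 2) *: k) *+ 2.
    by rewrite -scaler_nat scalerA mulrC divfK ?pnatr_eq0.
  have -> : c n.+1 *: k = ((c n / 2) *: k) *+ 3.
    by rewrite -scaler_nat scalerA /c exprS; congr (_ *: _); ring.
  move: IHp IHm; rewrite half; apply: selfadjoint_expand => //.
  - by rewrite cstarZ ks cs.
  - by rewrite cmulZr ek.
  - by rewrite cmulZl ke.
have cge n : n%:R <= c n *+ 2 /\ 1 <= c n.
  elim: n => [|n [IH1 IH2]]; first by rewrite /c expr0 mulr0n ler0n.
  have -> : c n.+1 = c n + c n / 2 by rewrite /c exprS; field.
  split; last by rewrite ler_wpDr // divr_ge0 // (le_trans ler01).
  by rewrite mulrnDl -[_ / 2 *+ 2]mulr_natr divfK ?pnatr_eq0 // -natr1 lerD.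
have bound n : `|k| * n%:R <= 2.
  have [lp' lm'] := grow n; have [n1 n2] := cge n.
  apply: (@le_trans _ _ `|c n *: k *+ 2|).
    rewrite normrMn normrZ (ger0_norm (le_trans ler01 n2)) mulrC -mulrnAl.
    by rewrite ler_wpM2r.
  have -> : c n *: k *+ 2 = (e + c n *: k) - (e - c n *: k).
    by rewrite opprB addrC addrA subrK mulr2n.
  by rewrite (le_trans (ler_normB _ _)) // -[2]/(1 + 1) lerD.
apply/eqP; rewrite -normr_eq0; apply/eqP.
have k0 := normr_ge0 k; set r := `|k| in bound k0 *.
have rE : r = (complex.Re r)%:C.
  by move: k0; case: (r) => a b; rewrite lecE /= => /andP[/eqP -> _].
move: bound k0; rewrite rE; set a := complex.Re r => bound a0.
have {}a0 : 0 <= a by move: a0; rewrite -[0]/(0%:C) lecR.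
have {}bound n : a * n%:R <= 2.
  by have := bound n; rewrite -!(rmorph_nat (real_complex R)) -rmorphM /= lecR.
have [->//|an0] := eqVneq a 0.
have ap : 0 < a by rewrite lt_neqAle eq_sym an0.
have := bound (Num.bound (2 / a)); rewrite leNgt -ltr_pdivrMl // mulrC.
by rewrite archi_boundP // divr_ge0.
Qed.

Lemma selfadjoint_extreme_nat (N : nat) (y : A) : (0 < N)%N ->
  y^† = y -> e ** y = y -> y ** e = y ->
  `|e *+ N + y| <= N%:R -> `|e *+ N - y| <= N%:R -> y = 0.
Proof.
move=> N0 ys ey ye lp lm.
have N0' : N%:R != 0 :> R[i] by rewrite pnatr_eq0 -lt0n.
have yE : y = N%:R *: (N%:R^-1 *: y) by rewrite scalerA divff // scale1r.
suff k0 : N%:R^-1 *: y = 0 by rewrite yE k0 scaler0.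
have div z : `|e *+ N + z| <= N%:R -> `|e + N%:R^-1 *: z| <= 1.
  move=> h; rewrite -(@ler_pM2l _ N%:R) ?ltr0n // mulr1.
  by rewrite -[X in X * _]normr_nat -normrZ scalerDr scaler_nat scalerA
    divff // scale1r.
apply: selfadjoint_extreme.
- by rewrite cstarZ ys fmorphV rmorph_nat.
- by rewrite cmulZr ey.
- by rewrite cmulZl ye.
- exact: div.
- by rewrite -scalerN div.
Qed.
End Extreme.

(** * Sums of projections *)

Section SumProj.
Variables (R : realType) (A : cstarAlgType R).

(** A norm form of the inequalities [0 <= e q_i e <= e]: each
    [e - 2 e q_i e = (e - 2 e q_i) e] is a contraction by
    [norm_mul_symmetry]. *)
Lemma norm_compression_sum (I : Type) (r : seq I) (e : A) (q : I -> A) :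
  projection e -> (forall i, projection (q i)) ->
  `|e *+ size r - (\sum_(i <- r) e ** q i ** e) *+ 2| <= (size r)%:R.
Proof.
move=> pe pq; elim: r => [|i r IH].
  by rewrite big_nil mul0rn subr0 mulr0n normr0.
rewrite big_cons mulrSr mulrnDl [X in _ - X]addrC opprD addrACA -natr1.
rewrite (le_trans (ler_normD _ _)) // lerD //.
have [ee es] := pe.
have -> : e - e ** q i ** e *+ 2 = (e - (e ** q i) *+ 2) ** e.
  by rewrite cmulBl !mulr2n cmulDl ee.
apply: norm_mul_le1; last exact: projection_norm.
by rewrite norm_mul_symmetry // projection_norm.
Qed.

(** Compressing [p = sum q_i] by [e = q_j] gives [e p e = e + h], where [h] is
    the sum of the [e q_i e] over the other indices. Now [h] is positive in the
    sense of [norm_compression_sum], while [|e + h| <= 1]; extremality of [e]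
    forces [h = 0]. Then [e p e = e], which says that
    [(e - p e)^† (e - p e) = 0]. *)
Lemma sum_projections_absorb (I : eqType) (r : seq I) (q : I -> A) (p : A) j :
  projection p -> (forall i, projection (q i)) ->
  p = \sum_(i <- r) q i -> j \in r -> p ** q j = q j.
Proof.
move=> pp pq pE jr; have [qq qs] := pq j; have [ppE ps] := pp.
pose e := q j; pose r' := rem j r.
pose h := \sum_(i <- r') e ** q i ** e.
have epe : e ** p ** e = e + h.
  by rewrite pE (big_rem j) //= cmulDr cmulDl qq qq cmul_sumr cmul_suml.
have eh : e ** h = h.
  by rewrite cmul_sumr; apply: eq_bigr => i _; rewrite !cmulA qq.
have he : h ** e = h.
  by rewrite cmul_suml; apply: eq_bigr => i _; rewrite -cmulA qq.
have hs : h^† = h.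
  rewrite cstar_sum; apply: eq_bigr => i _; have [_ is_] := pq i.
  by rewrite !cstarM is_ qs cmulA.
have e1 : `|e| <= 1 by exact: projection_norm.
have h0 : h *+ 2 = 0.
  (* [N e + 2 h] equals [(N - 2) e + 2 e p e], whose norm is at most [N]. *)
  apply: (@selfadjoint_extreme_nat _ _ e (pq j) (size r').+2) => //.
  - by rewrite mulr2n cstarD hs.
  - by rewrite mulr2n cmulDr eh.
  - by rewrite mulr2n cmulDl he.
  - have -> : e *+ (size r').+2 + h *+ 2 = e *+ size r' + (e + h) *+ 2.
      by rewrite -[(size r').+2]addn2 mulrnDr mulrnDl -addrA.
    rewrite (le_trans (ler_normD _ _)) //.
    rewrite -[(size r').+2]addn2 natrD lerD // normrMn.
      by rewrite lerMn2r e1 orbT.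
    rewrite -epe lerMn2r /=; apply: norm_mul_le1 => //.
    by apply: norm_mul_le1 => //; apply: projection_norm.
  have -> : e *+ (size r').+2 - h *+ 2 = (e *+ size r' - h *+ 2) + e *+ 2.
    by rewrite -[(size r').+2]addn2 mulrnDr addrAC.
  rewrite (le_trans (ler_normD _ _)) // -[(size r').+2]addn2 natrD lerD //.
    exact: norm_compression_sum.
  by rewrite normrMn lerMn2r e1 orbT.
have {}h0 : h = 0.
  by apply/eqP; move/eqP: h0; rewrite -scaler_nat scaler_eq0 pnatr_eq0.
apply/esym/eqP; rewrite -subr_eq0; apply/eqP/cstarM_eq0.
rewrite cstarB cstarM ps qs cmulBl !cmulBr qq.
have -> : q j ** p ** (p ** q j) = e ** p ** e.
  by rewrite cmulA -(cmulA (q j)) ppE.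
by rewrite cmulA epe h0 addr0 !subrr.
Qed.
End SumProj.

(** * Strings of edges and colour-ordered factorisations *)

Section Strings.
Variables (k : nat) (L : kgraph k).
Implicit Types (lam mu nu : mor L) (e f : edge L) (u a b : seq (edge L)).

Lemma deg_edge e : deg (edge_mor e) = basis (color e).
Proof. exact/eqP/(valP e). Qed.

Lemma basis_inj : injective (@basis k).
Proof.
move=> i j /ffunP /(_ i); rewrite !ffunE eqxx.
by case: eqP.
Qed.

Lemma edge_mor_inj : injective (@edge_mor k L).
Proof.
move=> e f ef; apply: val_inj.
have : color e = color f by apply: basis_inj; rewrite -!deg_edge ef.
move: ef; rewrite /edge_mor /color.
by case: (val e) (val f) => ? ? [? ?] /= -> ->.
Qed.

Lemma edge_of lam i :
  deg lam = basis i -> exists2 e, edge_mor e = lam & color e = i.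
Proof. by move=> /eqP h; exists (exist _ (lam, i) h). Qed.

Lemma addf_inj (m n n' : {ffun 'I_k -> nat}) : m + n = m + n' -> n = n'.
Proof.
move=> /ffunP h; apply/ffunP => i; have := h i; rewrite !ffunE.
exact: addnI.
Qed.

Lemma comp_inj mu nu mu' nu' : src mu = rng nu -> src mu' = rng nu' ->
  deg mu = deg mu' -> comp mu nu = comp mu' nu' -> mu = mu' /\ nu = nu'.
Proof.
move=> c1 c2 dmu cc.
have dnu : deg nu = deg nu'.
  by apply: (@addf_inj (deg mu)); rewrite -deg_comp // cc dmu deg_comp.
have [x [_ xu]] := factorisation (deg_comp c1).
have x1 : x = (mu, nu) by apply: xu.
have : x = (mu', nu') by apply: xu.
by rewrite x1 => -[-> ->].
Qed.

Lemma deg_eq0 lam : deg lam = 0 -> lam = idm (rng lam).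
Proof.
move=> d0; have [] := @comp_inj lam (idm (src lam)) (idm (rng lam)) lam.
- by rewrite rng_idm.
- by rewrite src_idm.
- by rewrite d0 deg_idm.
- by rewrite comp_idl comp_idr.
by [].
Qed.

Lemma split_edge lam i : deg lam i != 0%N ->
  exists e mu, [/\ color e = i, src (edge_mor e) = rng mu,
    lam = comp (edge_mor e) mu & deg lam = basis i + deg mu].
Proof.
move=> di; pose m : {ffun 'I_k -> nat} := [ffun j => (deg lam j - (j == i))%N].
have dE : deg lam = basis i + m.
  apply/ffunP => j; rewrite !ffunE; apply/esym/subnKC.
  by case: eqP => // ->; rewrite lt0n.
have [[a mu] [[/= da dmu c ->] _]] := factorisation dE.
have [e ea ei] := edge_of da; subst a.
by exists e, mu; rewrite deg_comp // deg_edge ei.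
Qed.

Definition color_le e f := (color e <= color f)%N.

Lemma rng_comp_string v u : is_string v u -> rng (comp_string v u) = v.
Proof.
elim: u v => [|e u IH] v /=; first by rewrite rng_idm.
by case=> <- /IH h; rewrite rng_comp ?h.
Qed.

Lemma is_string_cat v a b : is_string v (a ++ b) <->
  is_string v a /\ is_string (src (comp_string v a)) b.
Proof.
elim: a v => [|e a IH] v /=; first by rewrite src_idm; tauto.
split=> [[re /IH [ha hb]]|[[re ha] hb]].
  by split=> //; rewrite src_comp ?rng_comp_string.
by split=> //; apply/IH; move: hb; rewrite src_comp ?rng_comp_string.
Qed.

Lemma comp_string_cat v a b : is_string v (a ++ b) ->
  comp_string v (a ++ b) =
  comp (comp_string v a) (comp_string (src (comp_string v a)) b).
Proof.
elim: a v => [|e a IH] v /=.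
  by move=> h; rewrite src_idm -{2}(rng_comp_string h) comp_idl.
case=> re h; have /is_string_cat[ha hb] := h.
by rewrite IH // src_comp ?rng_comp_string // compA ?rng_comp_string.
Qed.

Lemma deg_comp_string v u : is_string v u ->
  deg (comp_string v u) = \sum_(e <- u) basis (color e).
Proof.
elim: u v => [|e u IH] v /=; first by rewrite big_nil deg_idm.
by case=> re h; rewrite big_cons deg_comp ?rng_comp_string // deg_edge IH.
Qed.

Lemma deg_comp_string_eq0 v u i : is_string v u ->
  (deg (comp_string v u) i == 0%N) = all (fun e => color e != i) u.
Proof.
move=> /deg_comp_string ->; elim: u => [|e u IH] /=.
  by rewrite big_nil ffunE.
by rewrite big_cons !ffunE addn_eq0 IH eqb0 eq_sym.
Qed.

Lemma path_color_le e u :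
  path color_le e u = all (color_le e) u && sorted color_le u.
Proof.
have tr : transitive color_le by move=> x y z; apply: leq_trans.
by rewrite (path_sortedE tr).
Qed.

(** An ordered string starts with an edge of the least colour in the degree;
    the factorisation property splits off such an edge. *)
Lemma ordered_string_exists lam : exists u,
  [/\ is_string (rng lam) u, comp_string (rng lam) u = lam & sorted color_le u].
Proof.
have [n] := ubnP (total_deg lam); elim: n lam => // n IH lam dn.
have [i0 di0|dz] := pickP (fun i => deg lam i != 0%N); last first.
  exists [::]; split=> //=; apply/esym/deg_eq0/ffunP => i.
  by have /negbFE/eqP -> := dz i; rewrite ffunE.
case: (@arg_minnP _ i0 (fun i => deg lam i != 0%N) (fun i => i : nat)) => //.
move=> i di imin.
have [e [mu [ce cmp lamE dE]]] := split_edge di.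
have [|u [us uc usort]] := IH mu.
  have : total_deg lam = (total_deg mu).+1.
    rewrite /total_deg dE; under eq_bigr do rewrite !ffunE.
    rewrite big_split /= (bigD1 i) //= eqxx big1 ?addn0 ?add1n //.
    by move=> j /negPf ->.
  by move=> dd; move: dn; rewrite dd.
exists (e :: u); split.
- by rewrite /= lamE rng_comp // cmp.
- by rewrite /= cmp uc.
rewrite /= path_color_le usort andbT; apply/allP => f fu.
rewrite /color_le ce imin // dE !ffunE addn_eq0 negb_and; apply/orP; right.
rewrite -uc deg_comp_string_eq0 //; apply/negP => /allP /(_ f fu).
by rewrite eqxx.
Qed.

(** The degree determines the colour of the first edge of an ordered string,
    and then the factorisation property determines that edge and the rest. *)
Lemma ordered_string_uniq v u w : is_string v u -> is_string v w ->
  sorted color_le u -> sorted color_le w ->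
  comp_string v u = comp_string v w -> u = w.
Proof.
have head_le e a b x : is_string x (e :: a) -> is_string x b ->
    comp_string x (e :: a) = comp_string x b -> sorted color_le b ->
    exists f b', b = f :: b' /\ color_le f e.
  move=> sa sb cc bs; have := deg_comp_string_eq0 (color e) sa.
  rewrite cc deg_comp_string_eq0 //= eqxx /= => /negbT /allPn[g gb].
  rewrite negbK => /eqP ge; case: b {sb cc} bs gb => // f b' bs gb.
  exists f, b'; split=> //; rewrite /color_le -ge; move: gb.
  rewrite inE => /predU1P[-> //|gb]; move: bs; rewrite /= path_color_le.
  by case/andP=> /allP /(_ _ gb).
elim: u v w => [|e u IH] v w su sw ou ow cc.
  case: w sw ow cc => // e w sw ow cc.
  by have [f [b' []]] := head_le _ _ _ _ sw su (esym cc) ou.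
have [f [w' [wE fe]]] := head_le _ _ _ _ su sw cc ow.
rewrite {}wE in sw ow cc *.
have [_ [_ [[<- _]]]] := head_le _ _ _ _ sw su (esym cc) ou.
rewrite /color_le => ef.
have cef : color e = color f by apply/val_inj/eqP; rewrite /= eqn_leq ef.
case: su sw cc => re su [rf sw] /= cc.
have [/edge_mor_inj ef' cc'] : edge_mor e = edge_mor f /\
    comp_string (src (edge_mor e)) u = comp_string (src (edge_mor f)) w'.
  by apply: comp_inj cc; rewrite ?rng_comp_string // !deg_edge cef.
rewrite -ef' in sw cc' *; rewrite (IH _ w' su sw) //.
- by move: ou; rewrite /= path_color_le => /andP[].
- by move: ow; rewrite /= path_color_le => /andP[].
Qed.

Definition ordered_string lam := (ordered_path lam).2.

Lemma ordered_path_uniq v u lam : is_string v u -> comp_string v u = lam ->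
  sorted color_le u -> ordered_path lam = (v, u).
Proof.
move=> su cu ou; rewrite /ordered_path; apply: xget_unique => //.
move=> [v' u'] [su' cu' ou']; rewrite /in_E /path_mor /= in su' cu' ou'.
have vv : v' = v by rewrite -(rng_comp_string su') cu' -cu rng_comp_string.
by subst v'; rewrite (ordered_string_uniq su' su) // cu.
Qed.

Lemma ordered_pathE lam : ordered_path lam = (rng lam, ordered_string lam).
Proof.
have [u [su cu ou]] := ordered_string_exists lam.
by rewrite /ordered_string (ordered_path_uniq su cu ou).
Qed.

Lemma ordered_stringP lam : [/\ is_string (rng lam) (ordered_string lam),
  comp_string (rng lam) (ordered_string lam) = lam &
  sorted color_le (ordered_string lam)].
Proof.
have [u [su cu ou]] := ordered_string_exists lam.
by rewrite /ordered_string (ordered_path_uniq su cu ou).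
Qed.

Lemma ordered_string_uniqE v u lam : is_string v u -> comp_string v u = lam ->
  sorted color_le u -> ordered_string lam = u.
Proof.
by move=> su cu ou; rewrite /ordered_string (ordered_path_uniq su cu ou).
Qed.

Lemma ordered_string_idm v : ordered_string (idm v) = [::] :> seq (edge L).
Proof. exact: (@ordered_string_uniqE v). Qed.

Lemma ordered_string_edge e : ordered_string (edge_mor e) = [:: e].
Proof.
by apply: (@ordered_string_uniqE (rng (edge_mor e))) => //=; rewrite comp_idr.
Qed.

Lemma ordered_string_cons e mu : src (edge_mor e) = rng mu ->
  (forall i : 'I_k, (i < color e)%N -> deg mu i = 0%N) ->
  ordered_string (comp (edge_mor e) mu) = e :: ordered_string mu.
Proof.
move=> cmp low; have [su cu ou] := ordered_stringP mu.
apply: (@ordered_string_uniqE (rng (edge_mor e))).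
- by rewrite /= cmp.
- by rewrite /= cmp cu.
rewrite /= path_color_le ou andbT; apply/allP => f fu.
rewrite /color_le leqNgt; apply/negP => /low.
rewrite -cu => /eqP; rewrite deg_comp_string_eq0 // => /allP /(_ f fu).
by rewrite eqxx.
Qed.

Lemma ordered_string_nil lam : (ordered_string lam == [::]) = (deg lam == 0).
Proof.
have [su cu _] := ordered_stringP lam; apply/eqP/eqP => [u0|/deg_eq0 ->].
  by rewrite -cu u0 /= deg_idm.
exact: ordered_string_idm.
Qed.

(** * Sorting strings by allowable transitions *)

Lemma unordered_split u : ~~ sorted color_le u -> exists a b e f,
  u = a ++ [:: e, f & b] /\ (color f < color e)%N.
Proof.
elim: u => // e [|f u] IH //=; rewrite negb_and /color_le -ltnNge.
case/orP=> [fe|/IH [a [b [e' [f' [-> ?]]]]]]; first by exists [::], u, e, f.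
by exists (e :: a), b, e', f'.
Qed.

(** The colours weighted by their distance to the end of the string: moving the
    smaller of two adjacent colours to the left decreases it, so sorting by
    adjacent swaps terminates. *)
Fixpoint weight u : nat :=
  if u is e :: u' then (size u * color e + weight u')%N else 0%N.

Lemma weight_swap a b e f e' f' : color e = color f' -> color f = color e' ->
  (color e < color f)%N ->
  (weight (a ++ [:: e, f & b]) < weight (a ++ [:: e', f' & b]))%N.
Proof.
move=> ef fe lt; elim: a => [|g a IH] /=; last first.
  by rewrite !size_cat /= ltn_add2l.
rewrite ef -fe; rewrite ef in lt; lia.
Qed.

Variables (R : realType) (phi : mor L -> R[i]).

Lemma swap_exists v a b e' f' : is_string v (a ++ [:: e', f' & b]) ->
  (color f' < color e')%N ->
  exists e f, [/\ color e = color f', color f = color e' &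
    transition phi (v, a ++ [:: e, f & b]) (v, a ++ [:: e', f' & b])
      (phi (comp (edge_mor e) (edge_mor f)))].
Proof.
move=> sw lt; have /is_string_cat[sa [re [rf sb]]] := sw.
have dE : deg (comp (edge_mor e') (edge_mor f')) =
    basis (color f') + basis (color e').
  by rewrite deg_comp // !deg_edge addrC.
have [[x y] [[/= dx dy cxy xyE] _]] := factorisation dE.
have [e ex ce] := edge_of dx; have [f fy cf] := edge_of dy; subst x y.
have re' : rng (edge_mor e) = src (comp_string v a).
  by rewrite -re -(rng_comp cxy) -xyE rng_comp.
have sf : src (edge_mor f) = src (edge_mor f').
  by rewrite -(src_comp cxy) -xyE src_comp.
have su : is_string v (a ++ [:: e, f & b]).
  by apply/is_string_cat; rewrite /= sf.
exists e, f; split=> //; split=> //.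
- rewrite /path_mor /= !comp_string_cat //=; congr comp.
  by rewrite sf !compA -?xyE ?rng_comp_string ?sf.
by exists a, b, e, f, e', f'; rewrite ce cf; split.
Qed.

Lemma sorting_exists v u : is_string v u ->
  exists z, sorting phi (v, u) (ordered_path (comp_string v u)) z.
Proof.
have [n] := ubnP (weight u); elim: n u => // n IH u wn su.
have [ou|/unordered_split] := boolP (sorted color_le u).
  by exists 1; rewrite (ordered_path_uniq su erefl ou); constructor.
move=> [a [b [e' [f' [uE lt]]]]]; rewrite {}uE in wn su *.
have [e [f [ce cf tr]]] := swap_exists su lt.
have [su' _ pp _] := tr.
rewrite /path_mor /= in pp; rewrite -pp.
have [||z hz] := IH (a ++ [:: e, f & b]) => //.
  apply: leq_trans (_ : _ <= weight (a ++ [:: e', f' & b]))%N wn.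
  by apply: weight_swap; rewrite ?ce ?cf.
by exists (phi (comp (edge_mor e) (edge_mor f)) * z); apply: SortingCons tr hz.
Qed.

(** The family is computed by following some chain of transitions to the
    ordered string, whichever it is, and [S_] is the value of one of them. *)
Lemma S_sorting v u : is_string v u ->
  sorting phi (v, u) (ordered_path (comp_string v u)) (S_ phi (v, u)).
Proof. by move=> /sorting_exists h; apply: (xgetPex 1 h). Qed.

Lemma transition_unordered w1 w z :
  transition phi w1 w z -> ~~ sorted color_le w.2.
Proof.
case=> _ _ _ [a [b [e [f [e' [f' [_ -> [cf lt ce] _]]]]]]].
apply/negP => /sortedP; rewrite size_cat /= => /(_ e (size a)).
rewrite -addn2 leq_add2l => /(_ isT).
rewrite !nth_cat ltnn subnn /= ltnNge leqnSn /= subSn // subnn /=.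
by rewrite /color_le cf -ce leqNgt lt.
Qed.

Lemma sorting_ordered w w' z :
  sorting phi w w' z -> sorted color_le w.2 -> z = 1.
Proof. by case=> // ? ? ? ? ? /transition_unordered /negP. Qed.

Lemma S_ordered v u : is_string v u -> sorted color_le u -> S_ phi (v, u) = 1.
Proof. by move=> /S_sorting /sorting_ordered; apply. Qed.

(** The only transition into a disordered string of two edges comes from the
    other factorisation of the same morphism, so here all chains have the same
    value. *)
Lemma S_swap v e' f' : is_string v [:: e'; f'] -> (color f' < color e')%N ->
  S_ phi (v, [:: e'; f']) = phi (comp (edge_mor e') (edge_mor f')).
Proof.
move=> sw lt; have := S_sorting sw; set S := S_ _ _; set u := ordered_path _.
have : sorted color_le u.2.
  by have [] := ordered_stringP (comp_string v [:: e'; f']).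
move wE : (v, _) => w ou hs; case: hs ou wE => [x ou xE|].
  by move: ou; rewrite -xE /= /color_le leqNgt lt.
move=> x w1 y z1 z [_ _ pp [a [b [e [f [e2 [f2 [w1E xE [cf ltef ce] ->]]]]]]]].
move=> hs _ xE'; rewrite -{}xE' /= in xE pp.
have [a0 b0] : a = [::] /\ b = [::].
  by case: a {w1E} xE => [|? [|? [|? ?]]] //; case: b.
rewrite {}a0 {}b0 /= in w1E xE.
have -> : z = 1.
  by apply: sorting_ordered hs _; rewrite w1E /= /color_le (ltnW ltef).
rewrite mulr1; congr phi; move: pp; rewrite /path_mor w1E /= => pp.
by move: pp; rewrite !comp_idr.
Qed.
End Strings.

(** * The twisted family of a representation *)

Section Representations.
Variables (R : realType) (k : nat) (L : kgraph k).
Hypothesis hrf : row_finite L.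
Implicit Types (lam mu nu : mor L) (e f : edge L) (u a b : seq (edge L)).

Definition edges_at (v : vertex L) (i : 'I_k) : set (edge L) :=
  [set e | rng (edge_mor e) = v /\ color e = i].

Definition paths_at (v : vertex L) (n : {ffun 'I_k -> nat}) : set (mor L) :=
  [set lam | rng lam = v /\ deg lam = n].

Lemma finite_edges_at v i : finite_set (edges_at v i).
Proof.
apply: (@sub_finite_set _ _ (@edge_mor k L @^-1` paths_at v (basis i))).
  by move=> e [re ce]; split=> //; rewrite deg_edge ce.
apply: finite_preimage; last exact: hrf.
by move=> e f _ _; apply: edge_mor_inj.
Qed.

(** Unique factorisation makes composition a bijection from pairs [(e, mu)] to
    paths. Which [mu] may follow [e] depends on [e]; the double sum is made
    rectangular by letting [mu] range over the union [M] of these sets and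
    extending the summand by zero. *)
Lemma sum_paths_split (V : nmodType) (F : mor L -> V) v i
    (m : {ffun 'I_k -> nat}) :
  \sum_(lam \in paths_at v (basis i + m)) F lam =
  \sum_(e \in edges_at v i)
     \sum_(mu \in paths_at (src (edge_mor e)) m) F (comp (edge_mor e) mu).
Proof.
pose E := edges_at v i.
pose M := \bigcup_(e in E) paths_at (src (edge_mor e)) m.
have fE : finite_set E by exact: finite_edges_at.
have fM : finite_set M by apply: bigcup_finite => // e _; exact: hrf.
pose C := [set x : edge L * mor L | src (edge_mor x.1) = rng x.2].
rewrite (reindex_fsbig (fun x => comp (edge_mor x.1) x.2)
  ((E `*` M) `&` C)); last first.
  split.
  - move=> [e mu] [[[/= re ce] [f _ [_ dmu]]] cmp].
    by split; rewrite ?rng_comp // deg_comp // deg_edge ce dmu.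
  - move=> [e mu] [f nu] /set_mem [[[/= re ce] _] c1].
    move=> /set_mem [[[/= rf cf] _] c2] cc.
    have [/edge_mor_inj -> -> //] : edge_mor e = edge_mor f /\ mu = nu.
    by apply: comp_inj cc; rewrite // !deg_edge ce cf.
  move=> lam [rlam dlam].
  have [[x y] [[/= dx dy cmp lamE] _]] := factorisation dlam.
  have [e ex ce] := edge_of dx; subst x.
  have re : rng (edge_mor e) = v by rewrite -rlam lamE rng_comp.
  by exists (e, y) => //; split=> //; split=> //=; exists e.
pose G e mu := if (e, mu) \in C then F (comp (edge_mor e) mu) else 0.
rewrite fsbig_mkcondr (eq_fsbigr (fun x => G x.1 x.2)); last by move=> [].
rewrite -pair_fsbig //; apply: eq_fsbigr => e /set_mem eE /=.
rewrite -(fsbig_mkcondr _ M [set mu | src (edge_mor e) = rng mu]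
  (fun mu => F (comp (edge_mor e) mu))).
 apply: eq_fsbigl; apply/seteqP; split=> mu /=.
  by move=> [[f _ [_ dmu]] cmp]; split.
by move=> [rmu dmu]; split=> //; exists e.
Qed.

Lemma no_sources_edge : no_sources L -> forall v i, edges_at v i !=set0.
Proof.
move=> hns v i; have [lam [rl dl]] := hns v (basis i).
by have [e el ei] := edge_of dl; exists e; split=> //; rewrite el.
Qed.

Variables (phi : mor L -> R[i]) (A : cstarAlgType R).
Variables (p : vertex L -> A) (s : edge L -> A).
Hypothesis (hps : phi_representation phi p s).

Lemma rep_projection v : projection (p v).
Proof. by case: hps => [[]]. Qed.

Lemma rep_src e : s e ** p (src (edge_mor e)) = s e.
Proof.
have [_ ss _ _] := hps; have [pp ps] := rep_projection (src (edge_mor e)).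
apply/eqP; rewrite -subr_eq0; apply/eqP/cstarM_eq0.
rewrite cstarB cstarM ps cmulBl !cmulBr !cmulA -!(cmulA (p _)) ss.
by rewrite !pp !subrr.
Qed.

Lemma rep_range_projection e : projection (s e ** (s e)^†).
Proof.
have [_ ss _ _] := hps; split; last by rewrite cstarM cstarK.
by rewrite cmulA -(cmulA (s e)) ss rep_src.
Qed.

(** The defining relations do not contain [p_r(e) s_e = s_e]. It holds because
    [p_r(e)] is a sum of projections one of which is [s_e s_e^†], and a
    projection that is a sum of projections absorbs each summand. *)
Lemma rep_rng e : p (rng (edge_mor e)) ** s e = s e.
Proof.
have [_ ss _ hsum] := hps; set v := rng _; set i := color e.
have ee : edges_at v i e by [].
have absorb : p v ** (s e ** (s e)^†) = s e ** (s e)^†.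
  apply: (@sum_projections_absorb _ _ _ (fset_set (edges_at v i))
    (fun f => s f ** (s f)^†) (p v) e).
  - exact: rep_projection.
  - exact: rep_range_projection.
  - rewrite -fsbig_finite; last exact: finite_edges_at.
    by apply: (hsum v i); exists e.
  - suff : e \in fset_set (edges_at v i) by [].
    by rewrite in_fset_set; [apply: mem_set|apply: finite_edges_at].
rewrite -[in LHS](rep_src e) -ss cmulA cmulA -(cmulA (p v)) absorb.
by rewrite -cmulA ss rep_src.
Qed.

(** Unlike [seq_prod], this has a useful value at the empty string, the vertex
    projection, and so turns concatenation into product without exception. *)
Fixpoint string_prod v u : A :=
  if u is e :: u' then s e ** string_prod (src (edge_mor e)) u' else p v.

Lemma string_prod_rng v u :
  is_string v u -> p v ** string_prod v u = string_prod v u.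
Proof.
case: u => [_|e u [<- _]] /=; last by rewrite cmulA rep_rng.
by have [] := rep_projection v.
Qed.

Lemma string_prod_cat v a b : is_string v (a ++ b) ->
  string_prod v (a ++ b) =
  string_prod v a ** string_prod (src (comp_string v a)) b.
Proof.
elim: a v => [|e a IH] v /=.
  by rewrite src_idm => /string_prod_rng.
case=> _ h; have /is_string_cat[ha _] := h.
by rewrite IH // cmulA src_comp // rng_comp_string.
Qed.

Lemma seq_prod_cons e f u :
  seq_prod s [:: e, f & u] = s e ** seq_prod s (f :: u).
Proof.
rewrite /=; elim: u f (s f) => [|g u IH] f x //=.
by rewrite -cmulA IH.
Qed.

Lemma string_prod_seq_prod v e u : is_string v (e :: u) ->
  string_prod v (e :: u) = seq_prod s (e :: u).
Proof.
elim: u e v => [|f u IH] e v; first by move=> _ /=; rewrite rep_src.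
by case=> re h; rewrite seq_prod_cons -(IH f (src (edge_mor e))).
Qed.

Lemma family_of_representationE lam :
  family_of_representation p s lam = string_prod (rng lam) (ordered_string lam).
Proof.
rewrite /family_of_representation -ordered_string_nil -/(ordered_string lam).
have [+ _ _] := ordered_stringP lam.
by case: (ordered_string lam) => [|e u] // /string_prod_seq_prod ->.
Qed.

(** Cancelling the common prefix and suffix, the two edges at which the strings
    differ are the two factorisations of one morphism, so the commutation
    relation applies. *)
Lemma string_prod_transition w1 w z : transition phi w1 w z ->
  string_prod w.1 w.2 = z *: string_prod w1.1 w1.2.
Proof.
move: w1 w => [v1 u1] [v w].
case=> i1 i2 pp [a [b [e [f [e' [f' [/= u1E wE [cf lt ce] ->]]]]]]].
subst u1 w; rewrite /in_E /path_mor /= in i1 i2 pp *.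
have vv : v1 = v by rewrite -(rng_comp_string i1) pp rng_comp_string.
subst v1.
have /is_string_cat[_ /= [re [rf sb]]] := i1.
have /is_string_cat[_ /= [re' [rf' sb']]] := i2.
move: pp; rewrite !comp_string_cat // => /comp_inj []//=.
  by rewrite rng_comp ?rng_comp // ?rng_comp_string.
  by rewrite rng_comp ?rng_comp // ?rng_comp_string.
move=> _; rewrite !compA ?rng_comp_string // => /comp_inj [].
- by rewrite src_comp // rng_comp_string.
- by rewrite src_comp // rng_comp_string.
- by rewrite !deg_comp // !deg_edge cf ce addrC.
move=> ef _; have sff : src (edge_mor f) = src (edge_mor f').
  by rewrite -(src_comp (esym rf)) ef src_comp.
have [_ _ hcomm _] := hps.
rewrite !string_prod_cat //= !cmulA -!(cmulA (string_prod v a)).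
rewrite (hcomm e f' f e') // sff.
by rewrite cmulZl cmulZr.
Qed.

Lemma string_prod_sorting w w' z : sorting phi w w' z ->
  string_prod w.1 w.2 = z *: string_prod w'.1 w'.2.
Proof.
elim=> [x|x y x' z1 z2 /string_prod_transition -> _ ->].
  by rewrite scale1r.
by rewrite scalerA.
Qed.

Lemma string_prod_star v u : is_string v u ->
  (string_prod v u)^† ** string_prod v u = p (src (comp_string v u)).
Proof.
have [_ ss _ _] := hps.
elim: u v => [|e u IH] v /=.
  by rewrite src_idm; have [pp ps] := rep_projection v; rewrite ps pp.
case=> _ h; rewrite cstarM -cmulA (cmulA (s e)^†) ss string_prod_rng //.
by rewrite IH // src_comp ?rng_comp_string.
Qed.

Hypothesis hns : no_sources L.

(** Splitting off an edge [e] of the least colour in [n] keeps strings ordered,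
    so [t_(e mu) = s_e t_mu], and the sum over [mu] collapses by induction. *)
Lemma family_CK4 v (n : {ffun 'I_k -> nat}) :
  let t := family_of_representation p s in
  t (idm v) = \sum_(lam \in paths_at v n) t lam ** (t lam)^†.
Proof.
move=> t; have tid x : t (idm x) = p x.
  by rewrite /t family_of_representationE rng_idm ordered_string_idm.
have [N] := ubnP (\sum_i n i)%N; elim: N n v => // N IH n v nN.
have [i0 ni0|nz] := pickP (fun i => n i != 0%N); last first.
  have n0 : n = 0.
    by apply/ffunP => i; have /negbFE/eqP -> := nz i; rewrite ffunE.
  have -> : paths_at v n = [set idm v].
    rewrite n0; apply/seteqP; split=> lam /=.
      by case=> <- /deg_eq0.
    by move=> ->; split; rewrite ?rng_idm ?deg_idm.
  by rewrite fsbig_set1 tid; have [pp ps] := rep_projection v; rewrite ps pp.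
case: (@arg_minnP _ i0 (fun i => n i != 0%N) (fun i => i : nat)) => //.
move=> i ni imin.
pose m : {ffun 'I_k -> nat} := [ffun j => (n j - (j == i))%N].
have nE : n = basis i + m.
  apply/ffunP => j; rewrite !ffunE; apply/esym/subnKC.
  by case: eqP => // ->; rewrite lt0n.
have [_ _ _ hsum] := hps.
rewrite nE sum_paths_split tid (hsum v i); last exact: no_sources_edge.
apply: eq_fsbigr => e /set_mem [re ce].
have tc mu : paths_at (src (edge_mor e)) m mu ->
    t (comp (edge_mor e) mu) = s e ** t mu.
  case=> rmu dmu; rewrite /t !family_of_representationE ordered_string_cons //=.
    by rewrite rmu.
  rewrite ce => j ji; rewrite dmu ffunE; apply/eqP/negPn/negP => nj.
  have : (i <= j)%N by apply: imin; apply: contraNneq nj => ->; rewrite sub0n.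
  by rewrite leqNgt ji.
have mN : (\sum_i m i < N)%N.
  have : (\sum_j n j = (\sum_j m j).+1)%N.
    rewrite nE; under eq_bigr do rewrite !ffunE.
    rewrite big_split /= (bigD1 i) //= eqxx big1 ?addn0 ?add1n //.
      by congr S; apply: eq_bigr => j _; rewrite ffunE.
    by move=> j /negPf ->.
  by move=> nm; rewrite nm in nN.
have -> : s e ** (s e)^† = s e ** p (src (edge_mor e)) ** (s e)^†.
  by rewrite rep_src.
rewrite -tid (IH m) // !fsbig_finite; try exact: hrf.
rewrite cmul_sumr cmul_suml big_seq [RHS]big_seq; apply: eq_bigr => mu.
rewrite in_fset_set; last exact: hrf.
by move=> /set_mem /tc ->; rewrite cstarM !cmulA.
Qed.

Lemma representation_twisted_family :
  twisted_family (c_ phi) (family_of_representation p s).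
Proof.
set t := family_of_representation p s.
have tid x : t (idm x) = p x.
  by rewrite /t family_of_representationE rng_idm ordered_string_idm.
split.
- have [[h1 h2] _ _ _] := hps.
  by split=> [v|v w vw]; rewrite !tid; [exact: h1|exact: h2].
- move=> mu nu cmp; rewrite /t !family_of_representationE.
  have [smu cmu _] := ordered_stringP mu.
  have [snu cnu _] := ordered_stringP nu.
  have sc : is_string (rng mu) (ordered_string mu ++ ordered_string nu).
    by apply/is_string_cat; rewrite cmu cmp.
  have cc : comp_string (rng mu) (ordered_string mu ++ ordered_string nu) =
      comp mu nu.
    by rewrite comp_string_cat // cmu cmp cnu.
  have := string_prod_sorting (S_sorting phi sc).
  rewrite cc ordered_pathE /= string_prod_cat // cmu cmp => ->.
  by rewrite /c_ !ordered_pathE.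
- move=> lam; rewrite tid /t family_of_representationE.
  by have [sl cl _] := ordered_stringP lam; rewrite string_prod_star // cl.
- by move=> v n; apply: family_CK4.
Qed.
End Representations.

(** * The representation of a twisted family *)

Section Families.
Variables (R : realType) (k : nat) (L : kgraph k) (phi : mor L -> R[i]).
Variables (B : cstarAlgType R) (t : mor L -> B).
Hypothesis (ht : twisted_family (c_ phi) t).

Lemma c_ordered mu nu : src mu = rng nu ->
  sorted (@color_le k L) (ordered_string mu ++ ordered_string nu) ->
  c_ phi mu nu = 1.
Proof.
move=> cmp; rewrite /c_ !ordered_pathE; apply: S_ordered.
have [smu cmu _] := ordered_stringP mu; have [snu cnu _] := ordered_stringP nu.
by apply/is_string_cat; rewrite cmu cmp.
Qed.

Lemma family_string v u : is_string v u -> sorted (@color_le k L) u ->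
  string_prod (fun x => t (idm x)) (t \o @edge_mor k L) v u =
  t (comp_string v u).
Proof.
have [_ hM _ _] := ht.
elim: u v => [|e u IH] v //= [re su] ou.
have ou' : sorted (@color_le k L) u.
  by move: ou; rewrite path_color_le => /andP[].
rewrite IH // hM ?rng_comp_string // c_ordered ?rng_comp_string ?scale1r //.
by rewrite ordered_string_edge (ordered_string_uniqE su erefl ou').
Qed.

(** The twist is trivial on a pair of edges in increasing colour order and is
    the value of [phi] on a pair in decreasing order, which turns the twisted
    multiplication into the commutation relation. *)
Lemma family_representation :
  phi_representation phi (fun v => t (idm v)) (t \o @edge_mor k L).
Proof.
have [h1 h2 h3 h4] := ht; split=> //.
- by move=> e /=; rewrite h3.
- move=> mu mu' nu nu' cm cn lt c1 c2 cc /=.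
  rewrite !h2 // [c_ phi (edge_mor mu) _]c_ordered //; last first.
    by rewrite !ordered_string_edge /= andbT /color_le ltnW.
  rewrite scale1r cc; congr (_ *: _).
  rewrite /c_ !ordered_pathE !ordered_string_edge; apply: S_swap.
    by rewrite /=.
  by rewrite -cm -cn.
move=> v i vLi _; rewrite (h4 v (basis i)) /=.
rewrite (@reindex_fsbig _ _ _ _ _ (@edge_mor k L) vLi) //; split.
- by move=> e [re ce]; split=> //; rewrite deg_edge ce.
- by move=> e f _ _; apply: edge_mor_inj.
move=> lam [rl dl]; have [e el ei] := edge_of dl.
by exists e => //; split=> //; rewrite el.
Qed.

End Families.

Theorem proposition5p3 (R : realType) (k : nat) (L : kgraph k)
    (hrf : row_finite L) (hns : no_sources L)
    (phi : mor L -> R[i]%C) (hphi : cubical_cocycle phi)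
    (A : cstarAlgType R) (p : vertex L -> A) (s : edge L -> A)
    (hA : universal_phi_representation phi p s) :
  let t := family_of_representation p s in
  twisted_family (c_ phi) t /\
  (forall (B : cstarAlgType R) (t' : mor L -> B),
     twisted_family (c_ phi) t' ->
     exists f : {linear A -> B}, star_hom f /\ forall lam, f (t lam) = t' lam).
Proof.
have [hps _ univ] := hA.
split; first exact: representation_twisted_family hps hns.
move=> B t' ht'; have [f [hf fp fs]] := univ _ _ _ (family_representation ht').
exists f; split=> // lam.
have [fM _] := hf.
rewrite (family_of_representationE hps).
have [sl cl ol] := ordered_stringP lam.
rewrite -[in RHS]cl -(family_string ht' sl ol).
elim: (ordered_string lam) (rng lam) => [|e u IH] v //=.
by rewrite fM fs IH.
Qed.
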